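(* Let $E$ be a left brace admitting an ideal $I$ such that $I=I_1\times\cdots\times I_r$, where $I_j$ is an ideal of $E$ for each $1\le j\le r$. Let $I_k^*=\prod_{j\ne k}I_j$. Then the following hold true: (i) $E$ splits over $I$ if and only if $E/I_k^*$ splits over $I/I_k^*$ for all $k=1,\dots,r$. (ii) $E$ splits over $I$ if and only if, for any $k\neq m$, the quotients $E/I_k$ and $E/I_m$ split over $I/I_k$ and $I/I_m$, respectively.
   Context: A skew left brace is a set $E$ with two group structures $(E,+)$ and $(E,\circ)$ such that $a\circ(b+c)=(a\circ b)-a+(a\circ c)$ for all $a,b,c$; it is a left brace if $(E,+)$ is abelian. The two identities coincide and are denoted $0$. Put $\lambda_a(b)=-a+(a\circ b)$. A sub-skew brace is a subset that is a subgroup of both $(E,+)$ and $(E,\circ)$. An ideal of $E$ is a subgroup $I$ of $(E,+)$ with $\lambda_a(I)\subseteq I$ for all $a\in E$, normal in both $(E,+)$ and $(E,\circ)$; the quotient $E/I$ is again a skew left brace. $E$ splits over an ideal $I$ if $I$ has a complement, i.e. there is a sub-skew brace $G$ of $E$ with $E=G+I$ and $G\cap I=\{0\}$. The decomposition $I=I_1\times\cdots\times I_r$ is an internal direct product, and $\prod_{j\neq k}I_j$ is the sum of the ideals $I_j$, $j\ne k$, inside $E$; it is an ideal of $E$. The indices $k,m$ range over $\{1,\dots,r\}$. *)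

(* Defs.v *)
From HB Require Import structures.
From mathcomp Require Import all_boot ssralg.
From mathcomp Require Import boolp classical_sets.

Set Implicit Arguments.
Unset Strict Implicit.
Unset Printing Implicit Defensive.

Import GRing.Theory.
Local Open Scope classical_set_scope.
Local Open Scope ring_scope.
Local Open Scope quotient_scope.

Notation "x ∘ y" := (@mul _ x%R y%R)
  (at level 40, left associativity) : ring_scope.

(* [(E, +)] is the (abelian) group of the zmodType structure, [(E, ∘)] the group
   of the groupType structure, with identity [1%g] and inverse [x^-1%g]. *)
HB.mixin Record Zmodule_Group_isLeftBrace E of GRing.Zmodule E & Group E := {
  circDr : forall a b c : E, a ∘ (b + c) = (a ∘ b) - a + (a ∘ c)
}.

#[short(type="leftBraceType")]
HB.structure Definition LeftBrace :=
  {E of GRing.Zmodule E & Group E & Zmodule_Group_isLeftBrace E}.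

Section LeftBraceTheory.
Variable E : leftBraceType.
Implicit Types (a b c x y : E) (A I : set E).

Definition lambda a b : E := - a + (a ∘ b).

Lemma circ1E : 1%g = 0 :> E.
Proof.
have := circDr (1%g : E) 0 0.
by rewrite addr0 mul1g sub0r addr0 => /eqP; rewrite eq_sym oppr_eq0 => /eqP.
Qed.

Lemma circE a b : a ∘ b = a + lambda a b.
Proof. by rewrite /lambda addrA subrr add0r. Qed.

Lemma lambdaD a x y : lambda a (x + y) = lambda a x + lambda a y.
Proof. by rewrite /lambda circDr !addrA. Qed.

Lemma lambda0 a : lambda a 0 = 0.
Proof. by apply: (addrI (lambda a 0)); rewrite -lambdaD !addr0. Qed.

Lemma lambdaN a x : lambda a (- x) = - lambda a x.
Proof. by apply/eqP; rewrite -addr_eq0 -lambdaD addNr lambda0. Qed.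

Lemma lambdaM a b x : lambda (a ∘ b) x = lambda a (lambda b x).
Proof.
rewrite [lambda b x]/lambda lambdaD lambdaN /lambda mulgA opprD opprK.
by rewrite [a - _]addrC addrA addrK.
Qed.

Lemma lambda1 x : lambda 1%g x = x.
Proof. by rewrite /lambda mul1g circ1E oppr0 add0r. Qed.

Lemma addE a x : a + x = a ∘ lambda (a^-1%g) x.
Proof. by rewrite circE -lambdaM mulgV lambda1. Qed.

Definition add_subgroup A : Prop :=
  [/\ A 0, forall x y, A x -> A y -> A (x + y) & forall x, A x -> A (- x)].

Definition circ_subgroup A : Prop :=
  [/\ A 1%g, forall x y, A x -> A y -> A (x ∘ y) & forall x, A x -> A x^-1%g].

Definition sub_brace A : Prop := add_subgroup A /\ circ_subgroup A.

Definition is_ideal I : Prop :=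
  [/\ add_subgroup I,
      forall a x, I x -> I (lambda a x),
      forall a x, I x -> I (a + x - a)
    & forall a x, I x -> I (a ∘ x ∘ a^-1%g)].

End LeftBraceTheory.

Record ideal (E : leftBraceType) := Ideal {
  ideal_set :> E -> Prop;
  ideal_axiom : is_ideal ideal_set
}.

Section IdealTheory.
Variables (E : leftBraceType) (I : ideal E).
Implicit Types a b x y : E.

Lemma ideal0 : I 0. Proof. by case: (ideal_axiom I) => -[]. Qed.
Lemma idealD x y : I x -> I y -> I (x + y).
Proof. by case: (ideal_axiom I) => -[_ + _] _ _ _; apply. Qed.
Lemma idealN x : I x -> I (- x).
Proof. by case: (ideal_axiom I) => -[_ _ +] _ _ _; apply. Qed.
Lemma ideal_lambda a x : I x -> I (lambda a x).
Proof. by case: (ideal_axiom I) => _ + _ _; apply. Qed.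
Lemma ideal_conj a x : I x -> I (a ∘ x ∘ a^-1%g).
Proof. by case: (ideal_axiom I) => _ _ _; apply. Qed.

Lemma idealV x : I x -> I (x^-1%g).
Proof.
move=> Ix.
have -> : x^-1%g = - lambda (x^-1%g) x.
  by apply/eqP; rewrite -addr_eq0 -circE mulVg circ1E.
exact/idealN/ideal_lambda.
Qed.

Definition ideal_rel : rel E := fun x y => `[< I (- x + y) >].

Lemma ideal_rel_refl : reflexive ideal_rel.
Proof. by move=> x; apply/asboolP; rewrite addNr; exact: ideal0. Qed.

Lemma ideal_rel_sym : symmetric ideal_rel.
Proof.
suff H x y : ideal_rel x y -> ideal_rel y x by move=> x y; apply/idP/idP; exact: H.
move=> /asboolP /idealN; rewrite opprD opprK addrC => ?; exact/asboolP.
Qed.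

Lemma ideal_rel_trans : transitive ideal_rel.
Proof.
move=> y x z /asboolP Ixy /asboolP Iyz; apply/asboolP.
by have := idealD Ixy Iyz; rewrite addrA -(addrA (- x)) subrr addr0.
Qed.

Canonical ideal_equiv :=
  EquivRel ideal_rel ideal_rel_refl ideal_rel_sym ideal_rel_trans.

Definition quo := {eq_quot ideal_equiv}.
HB.instance Definition _ := Choice.on quo.
HB.instance Definition _ := EqQuotient.on quo.

Local Notation pi := (\pi_quo : E -> quo).

Lemma piP x y : pi x = pi y <-> I (- x + y).
Proof.
by split=> [/eqmodP /asboolP | ?] //; apply/eqmodP/asboolP.
Qed.

Lemma piDl x i : I i -> pi (x + i) = pi x.
Proof. by move=> Ii; apply/esym/piP; rewrite addrA addNr add0r. Qed.

Lemma pi_coset x y : pi x = pi y -> exists2 i, I i & y = x + i.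
Proof. by move=> /piP Ii; exists (- x + y) => //; rewrite addrA subrr add0r. Qed.

Lemma piMl x i : I i -> pi (x ∘ i) = pi x.
Proof. by move=> Ii; rewrite circE piDl //; exact: ideal_lambda. Qed.

Lemma pi_coset_circ x y : pi x = pi y -> exists2 i, I i & y = x ∘ i.
Proof.
move=> /pi_coset[i Ii ->]; exists (lambda (x^-1%g) i); first exact: ideal_lambda.
exact: addE.
Qed.

Lemma pi_add x x' y y' : pi x = pi x' -> pi y = pi y' -> pi (x + y) = pi (x' + y').
Proof.
move=> /pi_coset[i Ii ->] /pi_coset[j Ij ->].
by rewrite addrACA; apply/esym/piDl/idealD.
Qed.

Lemma pi_opp x x' : pi x = pi x' -> pi (- x) = pi (- x').
Proof. by move=> /pi_coset[i Ii ->]; rewrite opprD piDl //; exact: idealN. Qed.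

Lemma pi_circ x x' y y' : pi x = pi x' -> pi y = pi y' -> pi (x ∘ y) = pi (x' ∘ y').
Proof.
move=> /pi_coset_circ[i Ii ->] /pi_coset_circ[j Ij ->].
have -> : (x ∘ i) ∘ (y ∘ j) = (x ∘ y) ∘ (y^-1%g ∘ i ∘ (y^-1%g)^-1%g) ∘ j.
  by rewrite invgK !mulgA -(mulgA x y) mulgV mulg1.
by apply/esym; rewrite piMl // piMl //; exact: ideal_conj.
Qed.

Lemma pi_inv x x' : pi x = pi x' -> pi (x^-1%g) = pi (x'^-1%g).
Proof.
move=> /pi_coset_circ[i Ii ->].
have -> : ((x ∘ i)^-1%g) = x^-1%g ∘ (x ∘ i^-1%g ∘ x^-1%g).
  by rewrite invgM !mulgA mulVg mul1g.
by apply/esym/piMl/ideal_conj/idealV.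
Qed.

Definition quo_zero : quo := pi 0.
Definition quo_add (u v : quo) : quo := pi (repr u + repr v).
Definition quo_opp (u : quo) : quo := pi (- repr u).
Definition quo_one : quo := pi 1%g.
Definition quo_circ (u v : quo) : quo := pi (repr u ∘ repr v).
Definition quo_inv (u : quo) : quo := pi ((repr u)^-1%g).

Lemma quo_addE x y : quo_add (pi x) (pi y) = pi (x + y).
Proof. by apply: pi_add; rewrite reprK. Qed.
Lemma quo_oppE x : quo_opp (pi x) = pi (- x).
Proof. by apply: pi_opp; rewrite reprK. Qed.
Lemma quo_circE x y : quo_circ (pi x) (pi y) = pi (x ∘ y).
Proof. by apply: pi_circ; rewrite reprK. Qed.
Lemma quo_invE x : quo_inv (pi x) = pi (x^-1%g).
Proof. by apply: pi_inv; rewrite reprK. Qed.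

Lemma piW (P : quo -> Prop) : (forall x, P (pi x)) -> forall u, P u.
Proof. by move=> H u; rewrite -[u]reprK; exact: H. Qed.

Lemma quo_addA : associative quo_add.
Proof.
by do 3![elim/piW => ?]; rewrite !quo_addE addrA.
Qed.
Lemma quo_addC : commutative quo_add.
Proof. by do 2![elim/piW => ?]; rewrite !quo_addE addrC. Qed.
Lemma quo_add0 : left_id quo_zero quo_add.
Proof. by elim/piW => x; rewrite quo_addE add0r. Qed.
Lemma quo_addN : left_inverse quo_zero quo_opp quo_add.
Proof. by elim/piW => x; rewrite quo_oppE quo_addE addNr. Qed.
HB.instance Definition _ :=
  GRing.isZmodule.Build quo quo_addA quo_addC quo_add0 quo_addN.

Lemma quo_circA : associative quo_circ.
Proof. by do 3![elim/piW => ?]; rewrite !quo_circE mulgA. Qed.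
Lemma quo_1circ : left_id quo_one quo_circ.
Proof. by elim/piW => x; rewrite quo_circE mul1g. Qed.
Lemma quo_circ1 : right_id quo_one quo_circ.
Proof. by elim/piW => x; rewrite quo_circE mulg1. Qed.
Lemma quo_Vcirc : left_inverse quo_one quo_inv quo_circ.
Proof. by elim/piW => x; rewrite quo_invE quo_circE mulVg. Qed.
Lemma quo_circV : right_inverse quo_one quo_inv quo_circ.
Proof. by elim/piW => x; rewrite quo_invE quo_circE mulgV. Qed.
HB.instance Definition _ :=
  isGroup.Build quo quo_circA quo_1circ quo_circ1 quo_Vcirc quo_circV.

Lemma piD x y : pi (x + y) = pi x + pi y.
Proof. by rewrite [RHS]quo_addE. Qed.
Lemma piN x : pi (- x) = - pi x.
Proof. by rewrite [RHS]quo_oppE. Qed.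
Lemma piM x y : pi (x ∘ y) = pi x ∘ pi y.
Proof. by rewrite [RHS]quo_circE. Qed.
Lemma piV x : pi (x^-1%g) = (pi x)^-1%g.
Proof. by rewrite [RHS]quo_invE. Qed.

Lemma quo_circDr (a b c : quo) : a ∘ (b + c) = (a ∘ b) - a + (a ∘ c).
Proof.
elim/piW: a => a; elim/piW: b => b; elim/piW: c => c.
by rewrite -!(piD, piM, piN) circDr.
Qed.
HB.instance Definition _ := Zmodule_Group_isLeftBrace.Build quo quo_circDr.

End IdealTheory.

Section QuotientIdeal.
Variables (E : leftBraceType) (I J : ideal E).

Local Notation pi := (\pi_(quo J) : E -> quo J).

Lemma quo_ideal_subproof : is_ideal (pi @` I).
Proof.
split; first split.
- by exists 0 => //; exact: ideal0.
- by move=> _ _ [x Ix <-] [y Iy <-]; exists (x + y); [exact: idealD|exact: piD].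
- by move=> _ [x Ix <-]; exists (- x); [exact: idealN|exact: piN].
- elim/piW => a _ [x Ix <-]; exists (lambda a x); first exact: ideal_lambda.
  by rewrite /lambda piD piN piM.
- elim/piW => a _ [x Ix <-]; exists x => //.
  by rewrite addrAC subrr add0r.
- elim/piW => a _ [x Ix <-]; exists (a ∘ x ∘ a^-1%g); first exact: ideal_conj.
  by rewrite !piM piV.
Qed.

(* The ideal [I/J] of [E/J], meaningful when [J] is contained in [I]. *)
Definition quo_ideal : ideal (quo J) := Ideal quo_ideal_subproof.

End QuotientIdeal.

Section SumIdeal.
Variables (E : leftBraceType) (r : nat) (I_ : 'I_r -> ideal E) (P : pred 'I_r).

Definition sum_set : set E :=
  [set x | exists2 f : 'I_r -> E,
     forall j, P j -> I_ j (f j) & x = \sum_(j | P j) f j].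

Lemma sum_setD x y : sum_set x -> sum_set y -> sum_set (x + y).
Proof.
move=> [f If ->] [g Ig ->]; exists (fun j => f j + g j).
  by move=> j Pj; apply: idealD; [exact: If|exact: Ig].
by rewrite big_split.
Qed.

Lemma sum_set0 : sum_set 0.
Proof. by exists (fun=> 0) => [j _|]; [exact: ideal0|rewrite big1]. Qed.

Lemma sum_set_lambda a x : sum_set x -> sum_set (lambda a x).
Proof.
move=> [f If ->]; exists (fun j => lambda a (f j)).
  by move=> j Pj; apply/ideal_lambda/If.
exact: (big_morph (lambda a) (lambdaD a) (lambda0 a)).
Qed.

Lemma sum_set_sub j x : P j -> I_ j x -> sum_set x.
Proof.
move=> Pj Ix; exists (fun k => if k == j then x else 0).
  by move=> k Pk; case: eqP => [->|_] //; exact: ideal0.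
rewrite (bigD1 j) //= eqxx big1 ?addr0 // => k /andP[_ /negPf->] //.
Qed.

Lemma sum_set_ideal : is_ideal sum_set.
Proof.
split; first split.
- exact: sum_set0.
- exact: sum_setD.
- move=> _ [f If ->]; exists (fun j => - f j); first by move=> j Pj; apply/idealN/If.
  by rewrite sumrN.
- exact: sum_set_lambda.
- by move=> a x Sx; rewrite addrAC subrr add0r.
move=> a x [f If ->].
suff /(_ 1%g) : forall b, sum_set
    (a ∘ lambda b (\sum_(j | P j) f j) ∘ a^-1%g) by rewrite lambda1.
apply: (big_ind (fun y => forall b, sum_set (a ∘ lambda b y ∘ a^-1%g))).
- by move=> b; rewrite lambda0 -circ1E mulg1 mulgV circ1E; exact: sum_set0.
- move=> y z Ky Kz b; rewrite lambdaD (addE (lambda b y)) -lambdaM.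
  set u := lambda b y; set v := lambda _ z.
  have -> : a ∘ (u ∘ v) ∘ a^-1%g = (a ∘ u ∘ a^-1%g) ∘ (a ∘ v ∘ a^-1%g).
    by rewrite !mulgA -(mulgA (a ∘ u) (a^-1%g) a) mulVg mulg1.
  by rewrite circE; apply: sum_setD; [exact: Ky|apply/sum_set_lambda/Kz].
- move=> j Pj b; apply: (sum_set_sub Pj).
  by apply/ideal_conj/ideal_lambda/If.
Qed.

Definition sum_ideal : ideal E := Ideal sum_set_ideal.

End SumIdeal.

(* For ideals, the additive direct decomposition is also one of [(I, ∘)]: if
   [x], [y] lie in distinct [I_ j], then [lambda x y - y] lies in both (for
   that of [x], write [x ∘ y = y ∘ x'] with [x'] a conjugate of [x]), so it
   vanishes and [x ∘ y = x + y]. *)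
Definition internal_direct_product (E : leftBraceType) (I : ideal E)
    (r : nat) (I_ : 'I_r -> ideal E) : Prop :=
  I = sum_ideal I_ xpredT :> set E /\
  forall k, I_ k `&` sum_ideal I_ (fun j => j != k) = [set 0].

Definition splits (E : leftBraceType) (I : ideal E) : Prop :=
  exists G : set E,
    [/\ sub_brace G,
        forall x, exists2 g, G g & exists2 i, I i & x = g + i
      & G `&` I = [set 0]].

(* Main.v *)
Require Import Defs.
From mathcomp Require Import all_boot ssralg.
From mathcomp Require Import boolp classical_sets.

(** For an ideal [J] inside [I], splitting of [E/J] over [I/J] amounts to a
    sub-brace [G] of [E] with [E = G + I] and [G ∩ I = J]. Given such a [G_k]
    for each [J = I_k^*], the intersection [G] of the [G_k] is a complement of
    [I]: it meets [I] in the intersection of the [I_k^*], which is trivial, and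
    if [x] lies in [G_k + i_k] with [i_k] in [I_k] for every [k], then
    [x - \sum_j i_j] lies in every [G_k], since [I_j] is contained in
    [I_k^*], hence in [G_k], for [j != k]. For (ii), every [I_j^*] contains
    [I_k] or [I_m], and splitting passes to larger ideals [J] by adding [J]
    to [G]. *)

Import GRing.Theory.
Local Open Scope classical_set_scope.
Local Open Scope ring_scope.
Local Open Scope quotient_scope.

Section RelativeComplement.
Context {E : leftBraceType}.
Implicit Types (I J : ideal E) (A G : set E).

(** The set [A] is a parameter so that one notion serves twice: [A = [set 0]] gives the complements
    of [I] in [E], and [A = J] the lifts to [E] of complements of [I/J] in [E/J]. *)
Definition relative_complement I A G : Prop :=
  [/\ sub_brace G,
      forall x, exists2 g, G g & exists2 i, I i & x = g + i
    & G `&` I = A].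

Lemma pi_eq0 J x : \pi_(quo J) x = 0 <-> J x.
Proof.
by split=> [/esym/Defs.piP|Jx]; [|apply/esym/Defs.piP]; rewrite oppr0 add0r.
Qed.

Lemma sub_brace_image J G :
  sub_brace G -> sub_brace ((\pi_(quo J) : E -> quo J) @` G).
Proof.
move=> [[G0 GD GN] [G1 GM GV]]; split; split.
- by exists 0.
- by move=> _ _ [x Gx <-] [y Gy <-]; exists (x + y); [exact: GD|exact: piD].
- by move=> _ [x Gx <-]; exists (- x); [exact: GN|exact: piN].
- by exists 1%g.
- by move=> _ _ [x Gx <-] [y Gy <-]; exists (x ∘ y); [exact: GM|exact: piM].
- by move=> _ [x Gx <-]; exists x^-1%g; [exact: GV|exact: piV].
Qed.

Lemma sub_brace_preimage J (G : set (quo J)) :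
  sub_brace G -> sub_brace ((\pi_(quo J) : E -> quo J) @^-1` G).
Proof.
move=> [[G0 GD GN] [G1 GM GV]]; split; split => //=.
- by move=> x y Gx Gy; rewrite piD; exact: GD.
- by move=> x Gx; rewrite piN; exact: GN.
- by move=> x y Gx Gy; rewrite piM; exact: GM.
- by move=> x Gx; rewrite piV; exact: GV.
Qed.

Lemma sub_brace_bigcap (T : Type) (G : T -> set E) :
  (forall k, sub_brace (G k)) -> sub_brace (\bigcap_k G k).
Proof.
move=> sG; split; split.
- by move=> k _; case: (sG k) => -[].
- move=> x y Gx Gy k _; case: (sG k) => -[_ GD _] _.
  by apply: GD; [exact: Gx|exact: Gy].
- by move=> x Gx k _; case: (sG k) => -[_ _ GN] _; apply/GN/Gx.
- by move=> k _; case: (sG k) => _ [].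
- move=> x y Gx Gy k _; case: (sG k) => _ [_ GM _].
  by apply: GM; [exact: Gx|exact: Gy].
- by move=> x Gx k _; case: (sG k) => _ [_ _ GV]; apply/GV/Gx.
Qed.

(** If [g] in [G] and [i] in [I] agree modulo [J], then [g] lies in [I] because [J] does, hence in
    [A], and so vanishes in the quotient. Since [G] and [G + J] have the same image in [E/J], the
    sum is never formed. *)
Lemma splits_quo I J A G : A `<=` J -> J `<=` I ->
  relative_complement I A G -> splits (quo_ideal I J).
Proof.
move=> AJ JI [sG covG GI]; exists ((\pi_(quo J) : E -> quo J) @` G); split.
- exact: sub_brace_image.
- elim/piW => x; have [g Gg [i Ii ->]] := covG x.
  exists (\pi_(quo J) g); first by exists g.
  by exists (\pi_(quo J) i); [exists i|exact: piD].
- apply/seteqP; split => [_ [[g Gg <-] [i Ii /pi_coset[j Jj gE]]]|_ ->].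
    have Ag : A g.
      by rewrite -GI; split=> //; rewrite gE; apply: idealD => //; exact: JI.
    by apply/pi_eq0/AJ.
  by case: (sG) => -[G0 _ _] _; split; [exists 0|exact: ideal0].
Qed.

Lemma splits_quo_relative_complement I J : J `<=` I ->
  splits (quo_ideal I J) -> exists G, relative_complement I J G.
Proof.
move=> JI [H [sH covH HI]]; exists ((\pi_(quo J) : E -> quo J) @^-1` H); split.
- exact: sub_brace_preimage.
- move=> x; have [u + [_ [i Ii <-] xE]] := covH (\pi_(quo J) x).
  (* Choosing [x - i] as representative of [u] makes the decomposition of [x] exact in [E], not only
     modulo [J]. *)
  have {xE}-> : u = \pi_(quo J) (x - i) by rewrite piD piN xE addrK.
  by move=> Hxi; exists (x - i) => //; exists i; rewrite ?subrK.
- apply/seteqP; split => [x [/= Hx Ix]|x Jx].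
    apply/pi_eq0; have : [set 0] (\pi_(quo J) x) by rewrite -HI; split=> //; exists x.
    exact.
  split; last exact: JI.
  by rewrite /= (pi_eq0 J x).2 //; case: sH => -[].
Qed.

End RelativeComplement.

Section DirectProduct.
Context {E : leftBraceType} {I : ideal E} {r : nat} {I_ : 'I_r -> ideal E}.
Hypothesis hI : internal_direct_product I I_.
Local Notation Istar k := (sum_ideal I_ (fun j : 'I_r => j != k)).

Lemma factor_sub k : I_ k `<=` I.
Proof. by move=> x Ix; rewrite hI.1; exact: (sum_set_sub (j := k)). Qed.

Lemma Istar_sub k : Istar k `<=` I.
Proof.
move=> _ [f If ->]; apply: (big_ind I).
- exact: ideal0.
- exact: idealD.
- by move=> j jk; apply/factor_sub/If.
Qed.

Lemma factor_sub_Istar j k : j != k -> I_ j `<=` Istar k.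
Proof. by move=> jk x; exact: sum_set_sub. Qed.

Lemma factor_decomposition k x : I x ->
  exists2 y, I_ k y & exists2 z, Istar k z & x = y + z.
Proof.
rewrite hI.1 => -[f If ->]; exists (f k); first exact: If.
exists (\sum_(j | j != k) f j); last by rewrite (bigD1 k).
by exists f => // j _; exact: If.
Qed.

(** Each component [f k] is [x] minus the other components, so it lies in both [I_ k] and [Istar k],
    which meet trivially. *)
Lemma bigcap_Istar x : I x -> (forall k, Istar k x) -> x = 0.
Proof.
rewrite hI.1 => -[f If xE] Sx; rewrite xE big1 // => k _.
suff : (I_ k `&` Istar k) (f k) by rewrite hI.2.
split; first exact: If.
have -> : f k = x - \sum_(j | j != k) f j by rewrite xE (bigD1 k) //= addrK.
by apply/idealD/idealN => //; exists f => // j _; exact: If.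
Qed.

Lemma splits_Istar : (forall k, splits (quo_ideal I (Istar k))) -> splits I.
Proof.
move=> sQ; have /choice[G GP] k : exists G, relative_complement I (Istar k) G.
  exact: (splits_quo_relative_complement _ _ (Istar_sub k) (sQ k)).
have sG k : sub_brace (G k) by case: (GP k).
have IstarG k : Istar k `<=` G k by case: (GP k) => _ _ <- x [].
have GD k x y : G k x -> G k y -> G k (x + y) by case: (sG k) => -[_ + _] _; apply.
exists (\bigcap_k G k); split; first exact: sub_brace_bigcap.
- move=> x; have /choice[f fP] k : exists y, I_ k y /\ G k (x - y).
    have [_ /(_ x)[g Gg [i Ii ->]] _] := GP k.
    (* The part [z] of [i] is absorbed by [G k], which contains [Istar k]; only [y] in [I_ k] has to
       be subtracted from [x]. *)
    have [y Iy [z Sz ->]] := factor_decomposition k i Ii.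
    by exists y; split=> //; rewrite (addrC y) addrA addrK; apply/GD/IstarG.
  exists (x - \sum_j f j); last first.
    exists (\sum_j f j); last by rewrite subrK.
    by rewrite hI.1; exists f => // j _; case: (fP j).
  move=> k _; rewrite (bigD1 k) //= opprD addrA; apply: GD; first by case: (fP k).
  by apply/IstarG/idealN; exists f => // j _; case: (fP j).
- apply/seteqP; split => [x [Gx Ix]|_ ->].
    apply: (bigcap_Istar x) => // k; case: (GP k) => _ _ <-.
    by split=> //; exact: Gx.
  by split; [case: (sub_brace_bigcap _ _ sG) => -[]|exact: ideal0].
Qed.

Lemma splits_quo_ideal (J : ideal E) : J `<=` I -> splits I ->
  splits (quo_ideal I J).
Proof.
by move=> JI [G GP]; apply: (splits_quo _ _ _ _ _ JI GP) => _ ->; exact: ideal0.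
Qed.

Lemma splits_two_factors k m : k != m ->
  splits (quo_ideal I (I_ k)) -> splits (quo_ideal I (I_ m)) -> splits I.
Proof.
move=> km sk sm; apply: splits_Istar => j.
(* As [k] and [m] differ, one of them is not [j]; call it [l]. Then [I_ l] is contained in
   [Istar j]. *)
have [l lj sl] : exists2 l, l != j & splits (quo_ideal I (I_ l)).
  by have [<-|kj] := eqVneq k j; [exists m; rewrite 1?eq_sym|exists k].
have [G GP] := splits_quo_relative_complement _ _ (factor_sub l) sl.
exact: (splits_quo _ _ _ _ (factor_sub_Istar _ _ lj) (Istar_sub j) GP).
Qed.

End DirectProduct.

Theorem theorem1p3 (E : leftBraceType) (I : ideal E)
    (r : nat) (I_ : 'I_r -> ideal E) (hI : internal_direct_product I I_) :
  let Istar := fun k : 'I_r => sum_ideal I_ (fun j : 'I_r => j != k) in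
  (splits I <-> forall k : 'I_r, splits (quo_ideal I (Istar k)))
  /\
  ((1 < r)%N ->
   (splits I <->
    forall k m : 'I_r, k != m ->
      splits (quo_ideal I (I_ k)) /\ splits (quo_ideal I (I_ m))))
  /\
  (forall k m : 'I_r, k != m ->
   (splits I <->
    splits (quo_ideal I (I_ k)) /\ splits (quo_ideal I (I_ m)))).
Proof.
move=> Istar.
have sF k : splits I -> splits (quo_ideal I (I_ k)).
  exact/splits_quo_ideal/factor_sub.
split; last split.
- split=> [sI k|]; last exact: splits_Istar.
  exact/splits_quo_ideal/sI/Istar_sub.
- move=> r_gt1; split=> [sI k m _|sQ]; first by split; exact: sF.
  (* The indices 0 and 1 form a pair to which [sQ] applies; for [r <= 1] the condition on pairs
     would be vacuous. *)
  have km : Ordinal (ltnW r_gt1) != Ordinal r_gt1 by [].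
  by have [sk sm] := sQ _ _ km; exact: (splits_two_factors hI _ _ km sk sm).
- move=> k m km; split=> [sI|[sk sm]]; first by split; exact: sF.
  exact: (splits_two_factors hI _ _ km sk sm).
Qed.
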